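(* Assume the Fourier Entropy-Influence (FEI) conjecture: there exists a universal constant $C>0$ such that for every $n$ and every $f\colon\{-1,1\}^n\to\{-1,1\}$, $\mathbb{H}(\hat f^2)\le C\cdot\mathsf{Inf}(f)$. Let $\varepsilon\in(0,1/2)$ be a constant. Then there is a constant $K>0$ (depending only on $\varepsilon$ and $C$) such that for all $n,d\ge1$, every $n$-variate flat polynomial $p$ of degree $d$ which $\varepsilon$-approximates some Boolean function $f\colon\{-1,1\}^n\to\{-1,1\}$ has sparsity at most $2^{Kd}$. (That is, a flat polynomial of degree $d$ and sparsity $2^{\omega(d)}$ cannot $\varepsilon$-approximate any Boolean function.)
   Context: All logarithms are base 2. For $S\subseteq[n]$, $\hat f(S)=\mathbb{E}_x[f(x)\prod_{i\in S}x_i]$ with $x$ uniform in $\{-1,1\}^n$. The Fourier entropy of Boolean $f$ is $\mathbb{H}(\hat f^2)=\sum_{S}\hat f(S)^2\log\frac{1}{\hat f(S)^2}$ (with $0\log\frac10=0$), and its total influence is $\mathsf{Inf}(f)=\sum_S|S|\hat f(S)^2$. A multilinear real polynomial $p(x)=\sum_{S\subseteq[n]}\hat p(S)\prod_{i\in S}x_i$ is flat if all its non-zero coefficients have the same magnitude; its sparsity is $|\{S:\hat p(S)\neq0\}|$. $p$ $\varepsilon$-approximates $f$ if $|p(x)-f(x)|\le\varepsilon$ for every $x\in\{-1,1\}^n$. *)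

(* Defs.v *)
From mathcomp Require Import all_boot all_order all_algebra.
From mathcomp Require Import reals exp.

Set Implicit Arguments.
Unset Strict Implicit.
Unset Printing Implicit Defensive.

Import Order.TTheory GRing.Theory Num.Theory.
Local Open Scope ring_scope.

(* The cube {-1,1}^n, each coordinate being stored as a sign bit:
   false stands for 1 and true for -1. *)
Definition cube (n : nat) := {ffun 'I_n -> bool}.

Definition coord (R : realType) (n : nat) (x : cube n) (i : 'I_n) : R :=
  (-1) ^+ x i.

Definition chi (R : realType) (n : nat) (S : {set 'I_n}) (x : cube n) : R :=
  \prod_(i in S) coord R x i.

Definition is_boolean (R : realType) (n : nat) (f : cube n -> R) : Prop :=
  forall x, f x = 1 \/ f x = -1.

Definition expect (R : realType) (n : nat) (g : cube n -> R) : R :=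
  (\sum_(x : cube n) g x) / #|cube n|%:R.

Definition fourier (R : realType) (n : nat) (f : cube n -> R)
  (S : {set 'I_n}) : R :=
  expect (fun x => f x * chi R S x).

Definition log2 (R : realType) (x : R) : R := ln x / ln 2.

(* When the coefficient is 0 the summand is 0 because of its first factor,
   which is the convention 0 log (1/0) = 0. *)
Definition fourier_entropy (R : realType) (n : nat) (f : cube n -> R) : R :=
  \sum_(S : {set 'I_n}) fourier f S ^+ 2 * log2 (1 / fourier f S ^+ 2).

Definition total_influence (R : realType) (n : nat) (f : cube n -> R) : R :=
  \sum_(S : {set 'I_n}) #|S|%:R * fourier f S ^+ 2.

Definition FEI (R : realType) (C : R) : Prop :=
  forall (n : nat) (f : cube n -> R), is_boolean f ->
    fourier_entropy f <= C * total_influence f.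

(* A multilinear polynomial is given by its coefficients: p S is the
   coefficient of \prod_(i in S) x_i. *)
Definition mlpoly (R : realType) (n : nat) := {ffun {set 'I_n} -> R}.

Definition mleval (R : realType) (n : nat) (p : mlpoly R n) (x : cube n) : R :=
  \sum_(S : {set 'I_n}) p S * chi R S x.

Definition mlsupp (R : realType) (n : nat) (p : mlpoly R n) :
  {set {set 'I_n}} := [set S | p S != 0].

Definition sparsity (R : realType) (n : nat) (p : mlpoly R n) : nat :=
  #|mlsupp p|.

(* The zero polynomial gets degree 0. *)
Definition mldegree (R : realType) (n : nat) (p : mlpoly R n) : nat :=
  (\max_(S in mlsupp p) #|S|)%N.

Definition flat (R : realType) (n : nat) (p : mlpoly R n) : Prop :=
  forall S T : {set 'I_n}, p S != 0 -> p T != 0 -> `|p S| = `|p T|.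

Definition approximates (R : realType) (n : nat) (eps : R) (p : mlpoly R n)
  (f : cube n -> R) : Prop :=
  forall x, `|mleval p x - f x| <= eps.

(* Main.v *)
Require Import Defs.
From mathcomp Require Import all_boot all_order all_algebra.
From mathcomp Require Import reals exp.
From mathcomp Require Import ring lra.

Import Order.TTheory GRing.Theory Num.Theory.
Local Open Scope ring_scope.

(** Write [a] for the common magnitude of the coefficients of [p] and [s] for its
    sparsity. By Parseval [s a^2 = E p^2 <= 9/4]. Across an edge of the cube where
    [f] changes sign, [p] moves by at least [1], so the total influence of [f] is
    at most [4] times that of [p], hence at most [9 d], and FEI bounds the Fourier
    entropy of [f] by [9 C d]. Conversely [E (f p) >= 1/2] forces the spectrum of
    [f] to have constant weight on those [S] in the support of [p] with
    [|f^(S)| <= 4 a]; there [f^(S)^2 <= 36 / s], so the entropy is at least a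
    constant times [log (s / 36)]. *)

(** * Expectation over the uniform cube *)

Section Expectation.
Set Implicit Arguments.
Unset Strict Implicit.
Context {R : realType} {n : nat}.
Implicit Types g h : cube n -> R.

Lemma card_cube_gt0 : 0 < #|cube n|%:R :> R.
Proof. by rewrite ltr0n; apply/card_gt0P; exists [ffun=> false]. Qed.

Lemma expect_cst (c : R) : expect (fun _ : cube n => c) = c.
Proof.
rewrite /expect sumr_const -[_ *+ _]mulr_natr mulfK //.
exact: lt0r_neq0 card_cube_gt0.
Qed.

Lemma eq_expect g h : g =1 h -> expect g = expect h.
Proof. by move=> gh; rewrite /expect (eq_bigr h). Qed.

Lemma expectD g h : expect (fun x => g x + h x) = expect g + expect h.
Proof. by rewrite /expect big_split mulrDl. Qed.

Lemma expectZ (c : R) g : expect (fun x => c * g x) = c * expect g.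
Proof. by rewrite /expect -mulr_sumr mulrA. Qed.

Lemma expect_sum (I : finType) (G : I -> cube n -> R) :
  expect (fun x => \sum_i G i x) = \sum_i expect (G i).
Proof. by rewrite /expect exchange_big mulr_suml. Qed.

Lemma le_expect g h : (forall x, g x <= h x) -> expect g <= expect h.
Proof.
by move=> gh; rewrite ler_pM2r ?invr_gt0 ?card_cube_gt0 // ler_sum.
Qed.

End Expectation.

(** * Edges of the cube: flipping one coordinate *)

Definition flip {n : nat} (i : 'I_n) (x : cube n) : cube n :=
  [ffun j => (j == i) (+) x j].

Lemma flipE (n : nat) (i j : 'I_n) (x : cube n) : flip i x j = (j == i) (+) x j.
Proof. exact: ffunE. Qed.

Lemma flipK (n : nat) (i : 'I_n) : involutive (flip i).
Proof. by move=> x; apply/ffunP => j; rewrite !flipE addbA addbb. Qed.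

(** * Characters, Parseval, Bessel and discrete derivatives *)

Section Fourier.
Set Implicit Arguments.
Unset Strict Implicit.
Variables (R : realType) (n : nat).
Implicit Types (g h : cube n -> R) (p : mlpoly R n) (S T : {set 'I_n}).

Lemma expect_flip i g : expect (fun x => g (flip i x)) = expect g.
Proof.
by rewrite /expect [in RHS](reindex_inj (can_inj (flipK i))).
Qed.

Lemma chi_flip i S x : chi R S (flip i x) = (-1) ^+ (i \in S) * chi R S x.
Proof.
rewrite /chi; have [iS|iS] := boolP (i \in S); last first.
  rewrite expr0 mul1r; apply: eq_bigr => j jS; rewrite /Defs.coord flipE.
  by case: eqP jS iS => // ->->.
rewrite !(bigD1 i iS) /= mulrA /Defs.coord flipE eqxx signr_addb; congr (_ * _).
by apply: eq_bigr => j /andP[_ ji]; rewrite flipE (negbTE ji).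
Qed.

Lemma chi_mulself S x : chi R S x * chi R S x = 1.
Proof.
rewrite /chi -big_split big1 // => i _.
by rewrite /= /Defs.coord -expr2 sqrr_sign.
Qed.

(** If [S] and [T] differ, flipping a coordinate that lies in exactly one of them negates the
    product, so the expectation equals its own opposite. *)
Lemma expect_chiM S T :
  expect (fun x => chi R S x * chi R T x) = (S == T)%:R.
Proof.
have [->|/eqP ST] := eqVneq S T.
  by rewrite (eq_expect (chi_mulself T)) expect_cst.
have [i ST_i] : exists i, (i \in S) != (i \in T).
  apply/existsP; apply: contra_notT ST => /existsPn ST.
  by apply/setP => i; apply/eqP; rewrite -[_ == _]negbK ST.
have E : expect (fun x => chi R S x * chi R T x)
       = - 1 * expect (fun x => chi R S x * chi R T x).
  rewrite -expectZ -[LHS](expect_flip i); apply: eq_expect => x.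
  rewrite !chi_flip; case: (i \in S) (i \in T) ST_i => -[] // _;
    by rewrite ?expr0 ?expr1; ring.
by rewrite mulr0n; lra.
Qed.

(** Linearity alone, for arbitrary [g]: taken with [g] a polynomial for Parseval and with [g]
    Boolean for the correlation bound. *)
Lemma expect_mulr_mleval g p :
  expect (fun x => g x * mleval p x) = \sum_S p S * fourier g S.
Proof.
rewrite -[RHS](_ : \sum_S expect (fun x => p S * (g x * chi R S x)) = _).
  rewrite -expect_sum; apply: eq_expect => x.
  by rewrite mulr_sumr; apply: eq_bigr => S _; ring.
by apply: eq_bigr => S _; rewrite expectZ.
Qed.

Lemma fourier_mleval p S : fourier (mleval p) S = p S.
Proof.
rewrite /fourier (@eq_expect R n _ (fun x => \sum_T p T * (chi R T x * chi R S x))).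
  rewrite expect_sum (bigD1 S) //= expectZ expect_chiM eqxx mulr1.
  rewrite big1 ?addr0 // => T TS.
  by rewrite expectZ expect_chiM (negbTE TS) mulr0.
by move=> x; rewrite mulr_suml; apply: eq_bigr => T _; rewrite mulrA.
Qed.

Lemma parseval_mleval p :
  expect (fun x => mleval p x ^+ 2) = \sum_S p S ^+ 2.
Proof.
rewrite (eq_expect (fun x => expr2 (mleval p x))) expect_mulr_mleval.
by apply: eq_bigr => S _; rewrite fourier_mleval expr2.
Qed.

(** Expand the nonnegative mean square of [g - mleval p], where [p] carries the Fourier coefficients
    of [g]. *)
Lemma bessel g : \sum_S fourier g S ^+ 2 <= expect (fun x => g x ^+ 2).
Proof.
pose p : mlpoly R n := [ffun S => fourier g S].
have : 0 <= expect (fun x => (g x - mleval p x) ^+ 2).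
  by rewrite -(@expect_cst R n 0); apply: le_expect => x; rewrite sqr_ge0.
rewrite (@eq_expect R n _ (fun x => (g x ^+ 2 + - 2 * (g x * mleval p x))
                                  + mleval p x ^+ 2)); last by move=> x; ring.
rewrite !expectD expectZ expect_mulr_mleval parseval_mleval.
have -> : \sum_S p S * fourier g S = \sum_S fourier g S ^+ 2.
  by apply: eq_bigr => S _; rewrite ffunE expr2.
have -> : \sum_S p S ^+ 2 = \sum_S fourier g S ^+ 2.
  by apply: eq_bigr => S _; rewrite ffunE.
by lra.
Qed.

(** There is no division by coordinate [i], so characters containing [i] are fixed and all others
    are killed. *)
Definition discrete_deriv (i : 'I_n) g (x : cube n) : R := (g x - g (flip i x)) / 2.

Lemma fourier_discrete_deriv i g S :
  fourier (discrete_deriv i g) S = (i \in S)%:R * fourier g S.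
Proof.
(* The sign compensates for evaluating [chi] at the flipped point, so both terms have the same
   expectation up to their weights. *)
rewrite /fourier (@eq_expect R n _ (fun x => 1 / 2 * (g x * chi R S x) +
   - (1 / 2) * (-1) ^+ (i \in S) * (g (flip i x) * chi R S (flip i x)))).
  rewrite expectD !expectZ (expect_flip i (fun x => g x * chi R S x)).
  by case: (i \in S); rewrite /= ?expr0 ?expr1; field.
by move=> x; rewrite chi_flip /discrete_deriv; case: (i \in S);
  rewrite ?expr0 ?expr1; field.
Qed.

Lemma sum_card_sqr (c : {set 'I_n} -> R) :
  \sum_(i : 'I_n) \sum_(S : {set 'I_n}) ((i \in S)%:R * c S) ^+ 2
  = \sum_(S : {set 'I_n}) #|S|%:R * c S ^+ 2.
Proof.
rewrite exchange_big; apply: eq_bigr => S _ /=.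
rewrite -sum1_card natr_sum mulr_suml [RHS]big_mkcond; apply: eq_bigr => i _.
by case: (i \in S); rewrite ?mul1r // mul0r expr0n.
Qed.

(** Bessel for each derivative; in the sum over [i], each [S] is counted once per element. *)
Lemma total_influence_le g :
  total_influence g <= \sum_i expect (fun x => discrete_deriv i g x ^+ 2).
Proof.
rewrite /total_influence -sum_card_sqr; apply: ler_sum => i _.
apply: le_trans (bessel (discrete_deriv i g)).
by under [leRHS]eq_bigr do rewrite fourier_discrete_deriv.
Qed.

(** The derivative of [p] along [i] is the polynomial [q] of the terms containing [i], to which
    Parseval applies. *)
Lemma sum_expect_discrete_deriv_mleval p :
  \sum_i expect (fun x => discrete_deriv i (mleval p) x ^+ 2)
  = \sum_(S : {set 'I_n}) #|S|%:R * p S ^+ 2.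
Proof.
rewrite -sum_card_sqr; apply: eq_bigr => i _.
pose q : mlpoly R n := [ffun S : {set 'I_n} => (i \in S)%:R * p S].
rewrite (@eq_expect R n _ (fun x => mleval q x ^+ 2)).
  by rewrite parseval_mleval; under eq_bigr do rewrite ffunE.
move=> x; congr (_ ^+ 2); rewrite /discrete_deriv /mleval -sumrB mulr_suml.
apply: eq_bigr => S _; rewrite ffunE chi_flip.
by case: (i \in S); rewrite /= ?expr0 ?expr1; field.
Qed.

End Fourier.

Lemma ln2_gt0 (R : realType) : 0 < ln 2 :> R.
Proof. by apply: ln_gt0; lra. Qed.

Lemma ler_log2 (R : realType) : {in Num.pos &, {mono @log2 R : x y / x <= y}}.
Proof.
by move=> x y x0 y0; rewrite /log2 ler_pM2r ?invr_gt0 ?ln2_gt0 // ler_ln.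
Qed.

(** * Spectrum and influence of a Boolean function approximated by [p] *)

Section Approximation.
Set Implicit Arguments.
Unset Strict Implicit.
Variables (R : realType) (n : nat) (eps : R).
Variables (p : mlpoly R n) (f : cube n -> R).
Hypotheses (eps_lt : eps < 1 / 2) (fb : is_boolean f).
Hypothesis pf : approximates eps p f.

Lemma approx_bounds x : - (1 / 2) <= mleval p x - f x <= 1 / 2.
Proof. by rewrite -ler_norml (le_trans (pf x)) // ltW. Qed.

(** Pointwise, [p] is at most 1 + 1/2 in absolute value. *)
Lemma approx_sqr_sum : \sum_S p S ^+ 2 <= 9 / 4.
Proof.
rewrite -parseval_mleval -(@expect_cst R n (9 / 4)); apply: le_expect => x.
by case: (fb x) (approx_bounds x) => -> /andP[]; nra.
Qed.

(** Pointwise, f p >= f^2 - 1/2 = 1/2. *)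
Lemma approx_correlation : 1 / 2 <= \sum_S p S * fourier f S.
Proof.
rewrite -expect_mulr_mleval -(@expect_cst R n (1 / 2)); apply: le_expect => x.
by case: (fb x) (approx_bounds x) => -> /andP[]; lra.
Qed.

Lemma approx_total_influence :
  total_influence f <= 9 * (mldegree p)%:R.
Proof.
apply: le_trans (total_influence_le f) _.
(* Where [f] changes sign its squared derivative is 1, while that of [p] is at least 1/4; elsewhere
   the left side vanishes. *)
have step i : expect (fun x => discrete_deriv i f x ^+ 2)
           <= 4 * expect (fun x => discrete_deriv i (mleval p) x ^+ 2).
  rewrite -expectZ; apply: le_expect => x; rewrite /discrete_deriv !exprMn.
  case: (fb x) (approx_bounds x) => -> /andP[];
  case: (fb (flip i x)) (approx_bounds (flip i x)) => -> /andP[];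
  have := sqr_ge0 (mleval p x - mleval p (flip i x)); nra.
apply: le_trans (ler_sum _ (fun i _ => step i)) _.
rewrite -mulr_sumr sum_expect_discrete_deriv_mleval.
have : \sum_(S : {set 'I_n}) #|S|%:R * p S ^+ 2
    <= \sum_S (mldegree p)%:R * p S ^+ 2.
  apply: ler_sum => S _; have [->|pS] := eqVneq (p S) 0.
    by rewrite expr0n !mulr0.
  rewrite ler_wpM2r ?sqr_ge0 // ler_nat /mldegree.
  by apply: (leq_bigmax_cond (F := fun S : {set 'I_n} => #|S|)); rewrite inE.
rewrite -mulr_sumr.
(* The constant 9 is 4 times 9/4. *)
have := approx_sqr_sum; have : 0 <= (mldegree p)%:R :> R by [].
by nra.
Qed.

Lemma boolean_sum_sqr : \sum_S fourier f S ^+ 2 <= 1.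
Proof.
apply: le_trans (bessel f) _; rewrite -[leRHS](@expect_cst R n 1).
by apply: le_expect => x; case: (fb x) => ->; rewrite ?sqrrN expr1n.
Qed.

Lemma boolean_fourier_le1 S : fourier f S ^+ 2 <= 1.
Proof.
apply: le_trans boolean_sum_sqr; rewrite (bigD1 S) //= lerDl.
by apply: sumr_ge0 => T _; apply: sqr_ge0.
Qed.

(** Squared coefficients are at most 1. This lets the entropy be bounded below on the support of [p]
    alone. *)
Lemma entropy_term_ge0 S : 0 <= fourier f S ^+ 2 * log2 (1 / fourier f S ^+ 2).
Proof.
have [->|f0] := eqVneq (fourier f S) 0; first by rewrite expr0n mul0r.
have q0 : 0 < fourier f S ^+ 2 by rewrite exprn_even_gt0.
apply: mulr_ge0; first exact: ltW.
apply: divr_ge0; last exact: ltW (ln2_gt0 R).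
by apply: ln_ge0; rewrite ler_pdivlMr // mul1r boolean_fourier_le1.
Qed.

Hypothesis p_flat : flat p.

(* The case [|f^(S)| > 4 a] makes the left side nonpositive; in the other case
   [|f^(S)| a <= 4 f^(S)^2 + a^2 / 16] by AM-GM. *)
Lemma flat_entropy_term S (L := log2 ((sparsity p)%:R / 36) : R) : 0 <= L ->
  36 <= (sparsity p)%:R :> R -> p S != 0 ->
  L * (p S * fourier f S - fourier f S ^+ 2 / 4 - p S ^+ 2 / 16)
  <= 4 * (fourier f S ^+ 2 * log2 (1 / fourier f S ^+ 2)).
Proof.
move=> L0 s36 pS; have H0 := entropy_term_ge0 S.
set b := fourier f S in H0 *.
(* By flatness, every nonzero term of the Parseval sum equals [p S ^+ 2]. *)
have pS2 : p S ^+ 2 * (sparsity p)%:R <= 9 / 4.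
  apply: le_trans approx_sqr_sum.
  rewrite (bigID (mem (mlsupp p))) /= [X in _ + X]big1 ?addr0; last first.
    by move=> T; rewrite inE negbK => /eqP->; rewrite expr0n.
  rewrite (eq_bigr (fun=> p S ^+ 2)) ?sumr_const ?mulr_natr //.
  move=> T; rewrite inE => pT.
  by rewrite -real_normK ?num_real // (p_flat pT pS) real_normK ?num_real.
have [->|b0] := eqVneq b 0.
  rewrite expr0n !mul0r !mulr0 subr0 mulr_ge0_le0 //.
  by have := sqr_ge0 (p S); lra.
have [small|large] := leP (b ^+ 2) (16 * p S ^+ 2); last first.
  have : p S * b <= b ^+ 2 / 4.
    have [|pb] := leP (p S * b) 0; first by have := sqr_ge0 b; lra.
    have [|bp] := leP (p S * b) (b ^+ 2 / 4) => //.
    by have := sqr_ge0 (p S); nra.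
  by have := sqr_ge0 (p S); nra.
have b2 : 0 < b ^+ 2 by rewrite exprn_even_gt0.
(* Here b^2 <= 16 p(S)^2 <= 16 (9/4) / s = 36 / s, the origin of the 36. *)
have : L <= log2 (1 / b ^+ 2).
  rewrite ler_log2 ?posrE ?divr_gt0 //; [|by lra].
  by rewrite ler_pdivlMr //; nra.
set l := log2 _ => Ll.
have : 4 * (b ^+ 2 * L) <= 4 * (b ^+ 2 * l) by rewrite !ler_wpM2l //; lra.
apply: le_trans.
have -> : 4 * (b ^+ 2 * L) = L * (4 * b ^+ 2) by ring.
apply: ler_wpM2l => //; have := sqr_ge0 (p S / 4 - 2 * b); have := sqr_ge0 b.
by nra.
Qed.

(** Sum [flat_entropy_term] over all [S]: the brackets total at least 1/2 - 1/4 - (9/4)/16 = 7/64.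
    Off the support the bracket is nonpositive. *)
Lemma flat_log_sparsity : 36 <= (sparsity p)%:R :> R ->
  7 / 64 * log2 ((sparsity p)%:R / 36) <= 4 * fourier_entropy f.
Proof.
move=> s36; set L := log2 _.
have L0 : 0 <= L.
  apply: divr_ge0; last exact: ltW (ln2_gt0 R).
  by apply: ln_ge0; lra.
rewrite /fourier_entropy mulr_sumr.
have : \sum_S L * (p S * fourier f S - fourier f S ^+ 2 / 4 - p S ^+ 2 / 16)
    <= \sum_S 4 * (fourier f S ^+ 2 * log2 (1 / fourier f S ^+ 2)).
  apply: ler_sum => S _; have [->|pS] := eqVneq (p S) 0.
    apply: (@le_trans _ _ 0); last by rewrite mulr_ge0 ?entropy_term_ge0.
    by rewrite mulr_ge0_le0 // expr0n /=; have := sqr_ge0 (fourier f S); lra.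
  exact: flat_entropy_term.
apply: le_trans; rewrite -mulr_sumr mulrC ler_wpM2l //.
rewrite !sumrB -!mulr_suml.
by have := boolean_sum_sqr; have := approx_sqr_sum; have := approx_correlation;
  lra.
Qed.

End Approximation.

Theorem lemma5p2 (R : realType) (C : R) (C_gt0 : 0 < C) (fei : FEI C)
  (eps : R) (eps_gt0 : 0 < eps) (eps_lt : eps < 1 / 2) :
  exists K : R, 0 < K /\
    forall (n d : nat), (1 <= n)%N -> (1 <= d)%N ->
    forall p : mlpoly R n, flat p -> mldegree p = d ->
    (exists f : cube n -> R, is_boolean f /\ approximates eps p f) ->
    (sparsity p)%:R <= 2 `^ (K * d%:R).
Proof.
(* FEI gives log2(s/36) <= (64/7) 4 (9 C d), and 2304/7 < 330; the 6 covers log2 36. *)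
exists (6 + 330 * C); split; first by lra.
move=> n d _ d1 p p_flat pd [f [fb pf]].
have d1R : 1 <= d%:R :> R by rewrite ler1n.
have Cd : 0 <= C * d%:R by rewrite mulr_ge0 // ltW.
have [->|s0] := posnP (sparsity p); first exact: powR_ge0.
have s0R : 0 < (sparsity p)%:R :> R by rewrite ltr0n.
have l0 := ln2_gt0 R.
(* The entropy bound needs log2(s/36) >= 0; smaller sparsities are below 2^6. *)
have [s36|s36] := leP (sparsity p)%:R (36 : R).
  apply: (@le_trans _ _ (2 `^ 6%:R)); first by rewrite powR_mulrn //; lra.
  by rewrite ler_powR //; [lra | nra].
have logs := flat_log_sparsity eps_lt fb pf p_flat (ltW s36).
have infl := approx_total_influence eps_lt fb pf.
rewrite pd in infl.
have fei_f := fei _ f fb.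
have : C * total_influence f <= C * (9 * d%:R) by rewrite ler_pM2l.
set t := C * total_influence f in fei_f * => tle.
have : log2 ((sparsity p)%:R / 36) <= 330 * C * d%:R by lra.
rewrite /log2 ler_pdivrMr // lnM ?posrE ?invr_gt0 // lnV ?posrE // => lns.
have ln36 : ln 36 <= 6 * ln 2 :> R.
  by rewrite mulrC mulr_natr -lnXn // ler_ln ?posrE //; lra.
(* After taking logarithms, d >= 1 absorbs the additive 6 into 6 d. *)
rewrite -ler_ln ?posrE ?powR_gt0 // ln_powR.
by nra.
Qed.
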